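(* Let $G_1$ be an $r_1$-regular graph on $n_1$ vertices and $m_1$ edges, and $G_2$ an arbitrary graph on $n_2$ vertices. Then $$\begin{aligned}\phi\left(L(G_1\underline{\vee} G_2);x\right)={}&x\cdot(x-2-n_2)^{m_1-n_1}\cdot\Big(x^2-(2+r_1+m_1+n_2)x+r_1n_2+r_1m_1+2m_1\Big)\\&\cdot\prod_{i=2}^{n_2}\Big(x-m_1-\mu_i(G_2)\Big)\cdot\prod_{i=2}^{n_1}\Big(x^2-(2+r_1+n_2)x+r_1n_2+\mu_i(G_1)\Big).\end{aligned}$$
   Context: All graphs are finite, simple and undirected, with at least one vertex. For a graph $G$ on $n$ vertices, $L(G)=D(G)-A(G)$ is its Laplacian matrix ($D(G)$ the diagonal matrix of vertex degrees, $A(G)$ the adjacency matrix), with eigenvalues $0=\mu_1(G)\le\mu_2(G)\le\cdots\le\mu_n(G)$. For an $n\times n$ matrix $M$, $\phi(M;x)=\det(xI_n-M)$. The subdivision graph $\mathcal{S}(G)$ is obtained from $G$ by inserting a new vertex into every edge of $G$; $I(G)$ denotes the set of inserted vertices. For vertex-disjoint graphs $G_1,G_2$, the subdivision-edge join $G_1\underline{\vee}G_2$ is the graph obtained from $\mathcal{S}(G_1)$ and $G_2$ by joining every vertex of $I(G_1)$ with every vertex of $V(G_2)$. The identity is understood as an identity of rational functions in $x$ (the exponent $m_1-n_1$ may be negative). *)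

(* Defs.v *)
From HB Require Import structures.
From mathcomp Require Import all_boot all_order all_algebra.
From mathcomp Require Import polyrcf.

Set Implicit Arguments.
Unset Strict Implicit.
Unset Printing Implicit Defensive.

Import Order.TTheory GRing.Theory Num.Theory.
Local Open Scope ring_scope.

Notation "p %:F" := (@FracField.tofrac _ p) : ring_scope.

Record sgraph := SGraph {
  vertex :> finType;
  adj : rel vertex;
  adj_sym : symmetric adj;
  adj_irrefl : irreflexive adj }.

Arguments adj {s} x y.

Definition edges (G : sgraph) : {set {set G}} :=
  [set [set x; y] | x in [set: G], y in [set w | adj x w]].

Definition degree (G : sgraph) (v : G) : nat := #|[set w | adj v w]|.

Definition regular (r : nat) (G : sgraph) : Prop :=
  forall v : G, degree v = r.

(* The subdivision graph: [inl v] is an original vertex and [inr e] is the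
   vertex inserted into the edge e. *)
Section Subdivision.
Variable G : sgraph.

Definition subdiv_vertex : finType := (G + {e : {set G} | e \in edges G})%type.

Definition subdiv_adj (a b : subdiv_vertex) : bool :=
  match a, b with
  | inl v, inr e | inr e, inl v => v \in val e
  | _, _ => false
  end.

Lemma subdiv_adj_sym : symmetric subdiv_adj.
Proof. by case=> [v|e] []. Qed.

Lemma subdiv_adj_irrefl : irreflexive subdiv_adj.
Proof. by case. Qed.

Definition subdiv : sgraph := SGraph subdiv_adj_sym subdiv_adj_irrefl.

Definition inserted : {set subdiv} :=
  [set a : subdiv_vertex | if a is inr _ then true else false].

End Subdivision.

Section SubdivisionEdgeJoin.
Variables G1 G2 : sgraph.

Definition sejoin_vertex : finType := (subdiv G1 + G2)%type.

Definition sejoin_adj (a b : sejoin_vertex) : bool :=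
  match a, b with
  | inl u, inl v => adj u v
  | inr u, inr v => adj u v
  | inl u, inr _ | inr _, inl u => u \in inserted G1
  end.

Lemma sejoin_adj_sym : symmetric sejoin_adj.
Proof.
by case=> u [] v //; [apply: (@adj_sym (subdiv G1)) | apply: (@adj_sym G2)].
Qed.

Lemma sejoin_adj_irrefl : irreflexive sejoin_adj.
Proof.
by case=> u; [apply: (@adj_irrefl (subdiv G1)) | apply: (@adj_irrefl G2)].
Qed.

Definition sejoin : sgraph := SGraph sejoin_adj_sym sejoin_adj_irrefl.

End SubdivisionEdgeJoin.

Section Laplacian.
Variables (R : rcfType) (G : sgraph).

Definition degree_mx : 'M[R]_#|G| :=
  diag_mx (\row_i (degree (enum_val i))%:R).

Definition adjacency_mx : 'M[R]_#|G| :=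
  \matrix_(i, j) (adj (enum_val i) (enum_val j))%:R.

Definition laplacian : 'M[R]_#|G| := degree_mx - adjacency_mx.

End Laplacian.

(* The eigenvalues of M lying in R, in nondecreasing order, each repeated
   according to its multiplicity as a root of the characteristic polynomial;
   for a symmetric M these are all n eigenvalues. *)
Definition eigenvalues (R : rcfType) (n : nat) (M : 'M[R]_n) : seq R :=
  flatten [seq nseq (mup a (char_poly M)) a | a <- rootsR (char_poly M)].

(* Numbered from 1: [mu R G 1] is the smallest Laplacian eigenvalue. *)
Definition mu (R : rcfType) (G : sgraph) (i : nat) : R :=
  (eigenvalues (laplacian R G))`_i.-1.

(* Main.v *)
(* Order the vertices of the join as V(G1), I(G1), V(G2).  With a = x - 2 - n2,
   the matrix x I - L is then

     [ (x - r1) I     B        0              ]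
     [     B^T       a I       J              ]
     [      0         J    (x - m1) I - L(G2) ]

   where B is the incidence matrix of G1, B B^T = 2 r1 I - L(G1), and J is the
   all-ones matrix.  Over the field of rational functions, take the Schur
   complement of the last block, then of the middle one: since L(G2) J = 0 and
   B J = r1 J, what remains is, up to the factor a^-1, t I + L(G1) minus a multiple
   of J, with t = a (x - r1) - 2 r1.  As L(G1) J = 0, subtracting a multiple of J
   only multiplies the determinant by a scalar.  Evaluating the characteristic
   polynomials of L(G1), L(G2) at -t and x - m1 gives the two products: these
   polynomials split over R by the spectral theorem, and the least root is
   mu_1 = 0. *)
Require Import Defs.
From mathcomp Require Import all_boot all_order all_algebra.
From mathcomp Require Import perm fraction ring.
From mathcomp Require Import complex polyrcf spectral.
Set Implicit Arguments.
Unset Strict Implicit.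
Unset Printing Implicit Defensive.

Import Order.TTheory GRing.Theory Num.Theory.
Local Open Scope ring_scope.

(** * Spectra of symmetric matrices over a real closed field *)

Lemma char_poly_conj (F : comUnitRingType) (n : nat) (P A : 'M[F]_n) :
  P \in unitmx -> char_poly (invmx P *m A *m P) = char_poly A.
Proof.
move=> Pu; rewrite /char_poly /char_poly_mx !map_mxM.
have PV : map_mx polyC (invmx P) *m map_mx polyC P = 1%:M.
  by rewrite -map_mxM mulVmx // map_mx1.
have -> : 'X%:M - map_mx polyC (invmx P) *m map_mx polyC A *m map_mx polyC P
  = map_mx polyC (invmx P) *m ('X%:M - map_mx polyC A) *m map_mx polyC P.
  by rewrite mulmxBr mulmxBl scalar_mxC -[_%:M *m _ *m _]mulmxA PV mulmx1.
by rewrite !det_mulmx mulrAC -det_mulmx PV det1 mul1r.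
Qed.

(** Over the complex numbers built on [R] the matrix is Hermitian, hence unitarily diagonalizable
    with real diagonal; injectivity of the embedding [f] brings the factorization back to [R]. *)
Lemma sym_char_poly_split (R : rcfType) (n : nat) (A : 'M[R]_n) :
  A^T = A -> exists s : seq R, char_poly A = \prod_(a <- s) ('X - a%:P).
Proof.
move=> symA; pose f := real_complex R.
have hA : map_mx f A \is hermsymmx.
  apply: realsym_hermsym; last first.
    by apply/mxOverP => i j; rewrite mxE; apply/complex_realP; exists (A i j).
  by apply/is_hermitianmxP; rewrite expr0 scale1r map_mx_id // map_trmx symA.
have /orthomx_spectralP eA := hermitian_normalmx hA.
have /mxOverP dR := hermitian_spectral_diag_real hA.
set d := spectral_diag _ in eA dR.
exists [seq complex.Re (d 0 i) | i <- enum 'I_n].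
apply: (map_poly_inj f).
rewrite map_char_poly eA char_poly_conj; last exact: spectral_unit.
rewrite rmorph_prod /= big_map big_enum /=.
rewrite /char_poly /char_poly_mx map_diag_mx -diag_const_mx -raddfB det_diag.
apply: eq_bigr => i _; rewrite !mxE.
by rewrite rmorphB /= map_polyX map_polyC /= RRe_real.
Qed.

(** Both sequences contain each [x] as often as its multiplicity as a root. On the left this uses
    that [rootsR] lists each root once and that a non-root has multiplicity 0. *)
Lemma perm_eigenvalues (R : rcfType) (n : nat) (A : 'M[R]_n) (s : seq R) :
  char_poly A = \prod_(a <- s) ('X - a%:P) -> perm_eq (eigenvalues A) s.
Proof.
move=> As; have A0 : char_poly A != 0 by rewrite monic_neq0 // char_poly_monic.
apply/allP => x _ /=; apply/eqP.
rewrite -(mu_prod_XsubC x s) -As count_flatten -map_comp sumnE big_map.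
transitivity (\sum_(a <- rootsR (char_poly A) | a == x) mup x (char_poly A))%N.
  rewrite [RHS]big_mkcond; apply: eq_bigr => a _ /=.
  by rewrite count_nseq /=; case: eqP => [->|_]; rewrite ?mul1n.
rewrite big_const_seq iter_addn_0 count_uniq_mem ?uniq_roots //.
have := roots_on_rootsR A0 x; rewrite inE /= => <-.
by case: (boolP (root _ x)) => [_|/mupNroot ->]; rewrite ?muln1 ?mul0n.
Qed.

Lemma char_poly_eigenvalues (R : rcfType) (n : nat) (A : 'M[R]_n) :
  A^T = A -> char_poly A = \prod_(a <- eigenvalues A) ('X - a%:P).
Proof.
case/sym_char_poly_split => s As.
by rewrite As; apply/perm_big; rewrite perm_sym perm_eigenvalues.
Qed.

Lemma size_eigenvalues (R : rcfType) (n : nat) (A : 'M[R]_n) :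
  A^T = A -> size (eigenvalues A) = n.
Proof.
move/char_poly_eigenvalues/(congr1 (fun p : {poly R} => size p)).
by rewrite size_char_poly size_prod_XsubC => -[].
Qed.

(** [rootsR] is strictly increasing, so the least root comes first; its multiplicity is positive, so
    its block is nonempty. *)
Lemma head_eigenvalues (R : rcfType) (n : nat) (A : 'M[R]_n) (a : R) :
  root (char_poly A) a -> (forall b, root (char_poly A) b -> a <= b) ->
  exists s, eigenvalues A = a :: s.
Proof.
move=> ra amin; have A0 : char_poly A != 0 by rewrite monic_neq0 // char_poly_monic.
have rootsE := roots_on_rootsR A0.
have := sorted_roots (- cauchy_bound (char_poly A)) (cauchy_bound (char_poly A))
  (char_poly A).
rewrite -/(rootsR _) /eigenvalues; case E: (rootsR _) => [|b rs] /=.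
  by have := rootsE a; rewrite E ra.
move=> brs; have -> : b = a.
  have := rootsE b; rewrite E mem_head inE /= => /amin ab.
  have := rootsE a; rewrite E ra /= inE => /esym/orP[/eqP //|ars].
  have /allP/(_ _ ars) := order_path_min lt_trans brs.
  by rewrite /= ltNge ab.
have : (0 < mup a (char_poly A))%N by rewrite mup_geq // expr1 dvdp_XsubCl.
by case: mup => //= k _; eexists.
Qed.

(** * The Laplacian spectrum *)

Lemma degreeE (G : sgraph) (v : G) : degree v = (\sum_(w : G) adj v w)%N.
Proof.
rewrite /degree -sum1_card big_mkcond.
by apply: eq_bigr => w _; rewrite inE; case: adj.
Qed.

Section LaplacianSpectrum.
Variables (R : rcfType) (G : sgraph).

Lemma laplacianE (i j : 'I_#|G|) : laplacian R G i j =
  (degree (enum_val i))%:R *+ (i == j) - (adj (enum_val i) (enum_val j))%:R.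
Proof. by rewrite !mxE. Qed.

Lemma laplacian_sym : (laplacian R G)^T = laplacian R G.
Proof.
apply/matrixP => i j; rewrite mxE !laplacianE adj_sym eq_sym.
by case: eqP => [->|_].
Qed.

(** In this difference form one sees that constant vectors are killed, and which sign L x has where
    x is maximal. *)
Lemma laplacian_mulE q (x : 'M[R]_(#|G|, q)) i k : (laplacian R G *m x) i k =
  \sum_j (adj (enum_val i) (enum_val j))%:R * (x i k - x j k).
Proof.
rewrite mxE; under eq_bigr do rewrite laplacianE mulrBl.
rewrite sumrB (bigD1 i) //= big1 ?addr0 ?eqxx => [|j /negbTE ji]; last first.
  by rewrite eq_sym ji mul0r.
under [in RHS]eq_bigr do rewrite mulrBr.
by rewrite sumrB -mulr_suml degreeE natr_sum
  (big_enum_val (A := G) (fun w => (adj _ w)%:R)).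
Qed.

Lemma laplacian_ones q : laplacian R G *m const_mx 1 = 0 :> 'M_(#|G|, q).
Proof.
apply/matrixP => i k; rewrite laplacian_mulE [RHS]mxE big1 // => j _.
by rewrite !mxE subrr mulr0.
Qed.

Lemma laplacian_root0 : (0 < #|G|)%N -> root (char_poly (laplacian R G)) 0.
Proof.
move=> n0; rewrite -eigenvalue_root_char; apply/eigenvalueP.
exists (const_mx 1).
  (* [eigenvalueP] speaks of row vectors; symmetry reduces to the column of ones. *)
  rewrite -laplacian_sym scale0r; apply: trmx_inj.
  by rewrite trmx_mul trmxK trmx_const laplacian_ones trmx0.
by apply/eqP => /rowP/(_ (Ordinal n0))/eqP; rewrite !mxE oner_eq0.
Qed.

(* At a vertex where an eigenvector is maximal, L x is nonnegative. *)
Lemma laplacian_root_ge0 a : root (char_poly (laplacian R G)) a -> 0 <= a.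
Proof.
rewrite -eigenvalue_root_char => /eigenvalueP[v0 v0L v0n0].
(* Changing the sign of the eigenvector if necessary gives a positive entry, so its maximal entry is
   positive too. *)
have [v [vL [i0 vi0]]] : exists v : 'cV[R]_#|G|,
    laplacian R G *m v = a *: v /\ exists i, 0 < v i 0.
  have [i vi] := elimT (rV0Pn v0) v0n0; move: vi; rewrite neq_lt => vi.
  have v0L' : laplacian R G *m v0^T = a *: v0^T.
    by rewrite -laplacian_sym -trmx_mul v0L linearZ.
  case/orP: vi => vi; [exists (- v0^T)|exists v0^T]; last first.
    by split=> //; exists i; rewrite mxE.
  by rewrite mulmxN v0L' scalerN; split=> //; exists i; rewrite !mxE oppr_gt0.
pose i := [arg max_(i > i0) v i 0]%O.
have imax j : v j 0 <= v i 0.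
  by rewrite /i; case: arg_maxP => //= k _; apply.
have vi : 0 < v i 0 by apply: lt_le_trans vi0 (imax _).
have : 0 <= (laplacian R G *m v) i 0.
  rewrite laplacian_mulE sumr_ge0 // => j _.
  by rewrite mulr_ge0 ?ler0n // subr_ge0.
by rewrite vL mxE pmulr_lge0.
Qed.

Lemma char_poly_laplacian : (0 < #|G|)%N ->
  char_poly (laplacian R G) =
  'X * \prod_(2 <= i < #|G|.+1) ('X - (mu R G i)%:P).
Proof.
move=> n0; have [s es] := head_eigenvalues (laplacian_root0 n0) laplacian_root_ge0.
have := size_eigenvalues laplacian_sym.
rewrite (char_poly_eigenvalues laplacian_sym) /mu es /= big_cons subr0 => sz.
(* The head mu_1 = 0 has become the factor ['X]. As [mu] counts from 1, index [i] from 2 on is entry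
   [i - 2] of the tail [s]. *)
congr (_ * _); rewrite (big_nth 0) -sz.
by rewrite -[X in \prod_(X <= _ < _) _]add0n (big_addn 0 _ 2) !subSS subn0;
  apply: eq_bigr => i _; rewrite addn2.
Qed.

(** Evaluation at [z] is a ring morphism, so it commutes with the determinant that defines the
    characteristic polynomial. *)
Lemma det_shift_laplacian (K : comNzRingType) (f : {rmorphism R -> K}) (z : K) :
  (0 < #|G|)%N -> \det (z%:M - map_mx f (laplacian R G)) =
  z * \prod_(2 <= i < #|G|.+1) (z - f (mu R G i)).
Proof.
move=> n0; transitivity (char_poly (map_mx f (laplacian R G))).[z].
  rewrite -[_.[z]]/(horner_eval z _) /char_poly -det_map_mx; congr (\det _).
  by apply/matrixP => i j; rewrite !mxE /= /horner_eval
    hornerD hornerN hornerC hornerMn hornerX.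
rewrite -map_char_poly char_poly_laplacian // rmorphM rmorph_prod /= map_polyX.
rewrite hornerM hornerX horner_prod; congr (_ * _); apply: eq_bigr => i _.
by rewrite rmorphB /= map_polyX map_polyC !hornerE.
Qed.

End LaplacianSpectrum.

Lemma det_add_laplacian (R : rcfType) (K : comNzRingType) (f : {rmorphism R -> K})
    (G : sgraph) (t : K) : (0 < #|G|)%N ->
  \det (t%:M + map_mx f (laplacian R G)) =
  t * \prod_(2 <= i < #|G|.+1) (t + f (mu R G i)).
Proof.
move=> n0.
have -> : t%:M + map_mx f (laplacian R G) =
    -1 *: ((- t)%:M - map_mx f (laplacian R G)).
  by rewrite scaleN1r opprB raddfN /= opprK addrC.
rewrite detZ det_shift_laplacian //.
(* The [#|G|] signs from [detZ] cancel against one from the factor [- t] and [#|G| - 1] from the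
   product. *)
under eq_bigr do rewrite -opprD -mulN1r.
rewrite big_split prodr_const_nat /= subSS subn1.
have {1}-> : #|G| = #|G|.-1.+1 by rewrite prednK.
rewrite exprS -!mulrA [-1 * _]mulN1r !mulNr !mulrN opprK mulrCA; congr (_ * _).
by rewrite mulrA -expr2 sqrr_sign mul1r.
Qed.

(** * Block determinants *)

(** [X] plays the part of D^-1 C: splitting off a unitriangular factor clears the corner [C]. In the
    applications [X] is explicit. *)
Lemma det_block_schurr (K : comPzRingType) (p q : nat) (A : 'M[K]_p) (B : 'M_(p, q))
    (C : 'M_(q, p)) (D : 'M_q) (X : 'M_(q, p)) :
  D *m X = C -> \det (block_mx A B C D) = \det (A - B *m X) * \det D.
Proof.
move=> DX; have -> : block_mx A B C D =
    block_mx (A - B *m X) B 0 D *m block_mx 1%:M 0 X 1%:M.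
  by rewrite mulmx_block !mulmx1 !mulmx0 DX !add0r subrK.
by rewrite det_mulmx det_ublock det_lblock !det1 !mulr1.
Qed.

Lemma det_block_schurl (K : comPzRingType) (p q : nat) (A : 'M[K]_p) (B : 'M_(p, q))
    (C : 'M_(q, p)) (D : 'M_q) (X : 'M_(p, q)) :
  A *m X = B -> \det (block_mx A B C D) = \det A * \det (D - C *m X).
Proof.
move=> AX; have -> : block_mx A B C D =
    block_mx A 0 C (D - C *m X) *m block_mx 1%:M X 0 1%:M.
  by rewrite mulmx_block !mulmx1 !mulmx0 AX !addr0 addrC subrK.
by rewrite det_mulmx det_ublock det_lblock !det1 !mulr1.
Qed.

Lemma mul_ones (K : pzRingType) (p q s : nat) :
  (const_mx 1 : 'M[K]_(p, q)) *m (const_mx 1 : 'M_(q, s)) = q%:R *: const_mx 1.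
Proof.
apply/matrixP => i j; rewrite !mxE (eq_bigr (fun=> 1)) => [|k _].
  by rewrite sumr_const card_ord mulr1.
by rewrite !mxE mulr1.
Qed.

(** The bordered matrix [N] has two Schur complements: eliminating the corner 1 leaves M - g J, and
    eliminating [M] leaves a scalar, because [t^-1 *: const_mx 1] solves M X = 1. *)
Lemma det_sub_ones (K : fieldType) (n : nat) (M : 'M[K]_n) (t g : K) :
  t != 0 -> (M *m const_mx 1 = t *: const_mx 1 :> 'cV_n) ->
  \det (M - g *: const_mx 1) = (1 - g * n%:R / t) * \det M.
Proof.
move=> t0 Mt.
pose N := block_mx (1%:M : 'M_1) (g *: const_mx 1 : 'rV_n) (const_mx 1) M.
have e1 : \det N = \det (M - g *: const_mx 1).
  rewrite (@det_block_schurl _ _ _ _ _ _ _ (g *: const_mx 1)) ?mul1mx // det1 mul1r.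
  by rewrite -scalemxAr mul_ones scale1r.
rewrite -e1 (@det_block_schurr _ _ _ _ _ _ _ (t^-1 *: const_mx 1)); last first.
  by rewrite -scalemxAr Mt scalerA mulVf // scale1r.
rewrite -scalemxAl -scalemxAr mul_ones !scalerA det_mx11 !mxE mulr1.
by rewrite mulrAC.
Qed.

(** The constant [c] comes from eliminating the last block, J (y I - L2)^-1 J = c J, and [d] from
    eliminating the middle one, (a I - c J)^-1 B^T = a^-1 (B^T + d J). *)
Lemma det_sejoin_block (K : fieldType) (n m p : nat) (a b y t r : K)
    (B : 'M[K]_(n, m)) (L1 : 'M_n) (L2 : 'M_p)
    (c := p%:R / y) (d := c * r / (a - c * m%:R)) :
  y != 0 -> a != 0 -> a - c * m%:R != 0 -> t != 0 -> t = a * b - 2 * r ->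
  B *m B^T = (2 * r)%:M - L1 ->
  (forall q, B *m const_mx 1 = r *: const_mx 1 :> 'M_(n, q)) ->
  (forall q, L1 *m const_mx 1 = 0 :> 'M_(n, q)) ->
  (forall q, L2 *m const_mx 1 = 0 :> 'M_(p, q)) ->
  \det (block_mx (block_mx b%:M B B^T a%:M) (col_mx 0 (const_mx 1))
                 (row_mx 0 (const_mx 1)) (y%:M - L2)) =
  (a ^+ n)^-1 * (1 - d * r * n%:R / t) * \det (t%:M + L1)
    * (a ^+ m * (1 - c * m%:R / a)) * \det (y%:M - L2).
Proof.
move=> y0 a0 acm0 t0 tE BB B1 L11 L21.
rewrite (@det_block_schurr _ _ _ _ _ _ _ (y^-1 *: row_mx 0 (const_mx 1))); last first.
  rewrite -scalemxAr mul_mx_row mulmx0 mulmxBl L21 subr0 mul_scalar_mx.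
  by rewrite scale_row_mx scaler0 scalerA mulVf ?scale1r.
congr (_ * _).
rewrite -scalemxAr mul_col_row mul0mx !mulmx0 mul0mx mul_ones.
rewrite -[X in X - _](addr0) scale_block_mx !scaler0 scalerA.
rewrite addr0 opp_block_mx add_block_mx !oppr0 !addr0.
have -> : y^-1 * p%:R = c by rewrite mulrC.
(* Since J B^T = r J, the multiples of J in (a I - c J)(B^T + d J) cancel exactly when d (a - c m) =
   c r. *)
rewrite (@det_block_schurr _ _ _ _ _ _ _ (a^-1 *: (B^T + d *: const_mx 1))); last first.
  have JB : (const_mx 1 : 'M_m) *m B^T = r *: const_mx 1.
    by rewrite -[const_mx 1]trmxK -trmx_mul trmx_const B1 linearZ /= trmx_const.
  rewrite -scalemxAr mulmxBl mul_scalar_mx -scalemxAl mulmxDr JB -scalemxAr mul_ones.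
  rewrite !scalerDr !scalerA; apply/matrixP => i j; rewrite !mxE /d.
  by field; rewrite acm0 a0.
congr (_ * _); last first.
  rewrite (@det_sub_ones _ _ _ a) ?det_scalar ?mul_scalar_mx //.
  by rewrite mulrC.
rewrite -scalemxAr mulmxDr BB -scalemxAr B1.
(* Here [t = a * b - 2 * r] enters. The ones vector is an eigenvector of [t%:M + L1] for [t], so
   [det_sub_ones] applies once more. *)
have -> : b%:M - a^-1 *: ((2 * r)%:M - L1 + d *: (r *: const_mx 1)) =
   a^-1 *: ((t%:M + L1) - (d * r) *: const_mx 1).
  apply/matrixP => i j; rewrite !mxE tE.
  by case: (i == j) => /=; rewrite ?mulr1n ?mulr0n; field.
rewrite detZ exprVn -mulrA; congr (_ * _).
by rewrite (@det_sub_ones _ _ _ t) // mulmxDl L11 addr0 mul_scalar_mx.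
Qed.

(** * The incidence matrix *)

Section Incidence.
Variable G : sgraph.

Lemma edgesP (e : {set G}) :
  reflect (exists u v : G, adj u v /\ e = [set u; v]) (e \in edges G).
Proof.
apply: (iffP imset2P) => [[u v _] | [u [v [uv ->]]]].
  by rewrite inE => uv ->; exists u, v.
by exists u v; rewrite ?inE.
Qed.

Lemma card_edge (e : {set G}) : e \in edges G -> #|e| = 2%N.
Proof.
case/edgesP => u [v [uv ->]]; rewrite cards2.
by case: eqP uv => // ->; rewrite adj_irrefl.
Qed.

(** The map from v to {u, v} is a bijection from the neighbours of [u] to the edges at [u]; its
    injectivity rests on the absence of loops. *)
Lemma big_edges_at (K : nmodType) (u : G) (F : {set G} -> K) :
  \sum_(e in edges G | u \in e) F e = \sum_(v | adj u v) F [set u; v].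
Proof.
have inj : {in [set v | adj u v] &, injective (fun v => [set u; v])}.
  move=> v w; rewrite !inE => uv uw /setP/(_ v); rewrite !inE eqxx orbT.
  by case: eqP uv => [->|_ _ /esym/eqP //]; rewrite adj_irrefl.
have -> : \sum_(v | adj u v) F [set u; v] = \sum_(v in [set v | adj u v]) F [set u; v].
  by apply: eq_bigl => v; rewrite inE.
rewrite -(big_imset F inj) /=; apply: eq_bigl => e.
apply/andP/imsetP => [[/edgesP[v [w [vw ->]]]] | [v]].
  rewrite !inE => /orP[] /eqP -> ; first by exists w; rewrite ?inE.
  by exists v; rewrite ?inE 1?adj_sym // setUC.
rewrite inE => uv ->; rewrite !inE eqxx; split=> //.
by apply/edgesP; exists u, v.
Qed.

(** Double counting of the incident vertex-edge pairs: every edge has two ends. *)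
Lemma sum_degree : (\sum_(v : G) degree v = 2 * #|edges G|)%N.
Proof.
transitivity (\sum_(v : G) \sum_(e in edges G | v \in e) 1)%N.
  apply: eq_bigr => v _; rewrite big_edges_at sum1_card.
  by apply: eq_card => w; rewrite inE.
rewrite (exchange_big_dep [in edges G]) /= => [|v e _ /andP[] //].
rewrite mulnC -sum_nat_const; apply: eq_bigr => e eE.
rewrite -(card_edge eE) -sum1_card; apply: eq_bigl => v.
by rewrite eE.
Qed.

(** The same type as the inserted vertices in [subdiv_vertex], so that these index the columns of
    B. *)
Definition edge : finType := {e : {set G} | e \in edges G}.

Definition incidence_mx (K : pzSemiRingType) : 'M[K]_(#|G|, #|edge|) :=
  \matrix_(i, j) (enum_val i \in val (enum_val j : edge))%:R.

Lemma sum_edges_at (v : G) : (\sum_(e : edge) (v \in val e) = degree v)%N.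
Proof.
rewrite -(big_sub [in edges G] (fun e => v \in e : nat)).
rewrite (eq_bigr (fun e : {set G} => if v \in e then 1 else 0)%N) => [|e _];
  last by case: ifP.
by rewrite -big_mkcondr big_edges_at sum1_card; apply: eq_card => w; rewrite inE.
Qed.

Lemma incidence_mul_ones (K : pzSemiRingType) r q : regular r G ->
  incidence_mx K *m const_mx 1 = const_mx r%:R :> 'M_(#|G|, q).
Proof.
move=> reg; apply/matrixP => i k; rewrite !mxE.
under eq_bigr do rewrite !mxE mulr1.
rewrite -natr_sum -(big_enum_val (A := edge) (fun e => enum_val i \in val e : nat)).
by rewrite sum_edges_at reg.
Qed.

(** An entry of B B^T counts the edges containing both [u] and [v]: the degree on the diagonal,
    adjacency off it. Hence B B^T = r I + A = 2 r I - L. *)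
Lemma incidence_mul_tr (R : rcfType) r : regular r G ->
  incidence_mx R *m (incidence_mx R)^T = (2 * r)%:R%:M - laplacian R G.
Proof.
move=> reg; apply/matrixP => i k; rewrite !mxE reg.
under eq_bigr do rewrite !mxE -natrM mulnb.
set u := enum_val i; set v := enum_val k.
rewrite -(big_enum_val (A := edge)
            (fun e => ((u \in val e) && (v \in val e))%:R)).
rewrite -(big_sub [in edges G] (fun e => ((u \in e) && (v \in e))%:R)).
have -> : \sum_(e in edges G) ((u \in e) && (v \in e))%:R =
    \sum_(e in edges G | u \in e) (v \in e)%:R :> R.
  by rewrite big_mkcondr; apply: eq_bigr => e _; case: ifP.
rewrite big_edges_at; case: (eqVneq i k) => [ik|ik].
  have -> : v = u by rewrite /u ik.
  rewrite (eq_bigr (fun=> 1)) => [|w _]; last by rewrite !inE eqxx.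
  rewrite sumr_const adj_irrefl subr0 !mulr1n mul2n -addnn natrD addrK.
  by rewrite -(reg u); congr (_%:R); apply: eq_card => w; rewrite inE.
rewrite !mulr0n !sub0r opprK.
(* As [v] differs from [u], it lies in {u, w} only for w = v, so a single summand survives. *)
rewrite (eq_bigr (fun w => (v == w)%:R)) => [|w _]; last first.
  by rewrite !inE (inj_eq enum_val_inj) eq_sym (negbTE ik).
rewrite big_mkcond (bigD1 v) //= eqxx big1 ?addr0 => [|w /negbTE].
  by case: adj.
by rewrite eq_sym => ->; case: ifP.
Qed.

End Incidence.

(** * The subdivision-edge join *)

(** The two numberings of [T] differ by a permutation applied to both rows and columns, whose sign
    enters squared. This frees the Laplacian from the numbering by [enum_val], so that blocks can
    appear. *)
Lemma det_reindex (K : comPzRingType) (T : finType) (F : T -> T -> K) (n : nat)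
    (g : 'I_n -> T) : bijective g ->
  \det (\matrix_(i < #|T|, j < #|T|) F (enum_val i) (enum_val j)) =
  \det (\matrix_(i, j) F (g i) (g j)).
Proof.
move=> gbij; have nT : n = #|T| by rewrite -(bij_eq_card gbij) card_ord.
subst n; have sI : injective (enum_rank \o g).
  exact: inj_comp enum_rank_inj (bij_inj gbij).
pose s := perm sI; set A := \matrix_(i, j) _.
have -> : \matrix_(i, j) F (g i) (g j) = row_perm s (col_perm s A).
  by apply/matrixP => i j; rewrite !mxE !permE /= !enum_rankK.
rewrite row_permE col_permE !det_mulmx !det_perm odd_permV mulrCA mulrA.
by rewrite -mulrA -expr2 sqrr_sign mulr1.
Qed.

Section SejoinIndex.
Variables G1 G2 : sgraph.

Definition sejoin_index (i : 'I_(#|G1| + #|edge G1| + #|G2|)) : sejoin G1 G2 :=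
  match split i with
  | inl j => match split j with
             | inl v => inl (inl (enum_val v))
             | inr e => inl (inr (enum_val e))
             end
  | inr w => inr (enum_val w)
  end.

Lemma sejoin_index_bij : bijective sejoin_index.
Proof.
exists (fun x : sejoin G1 G2 => match x with
  | inl (inl v) => lshift #|G2| (lshift #|edge G1| (enum_rank v))
  | inl (inr e) => lshift #|G2| (rshift #|G1| (enum_rank e))
  | inr w => rshift (#|G1| + #|edge G1|) (enum_rank w)
  end).
  move=> i; rewrite /sejoin_index; case: split_ordP => [j ->|w ->]; last first.
    by rewrite enum_valK.
  by case: split_ordP => k ->; rewrite enum_valK.
move=> [[v|e]|w]; rewrite /sejoin_index.
- by rewrite (unsplitK (inl _)) (unsplitK (inl _)) enum_rankK.
- by rewrite (unsplitK (inl _)) (unsplitK (inr _)) enum_rankK.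
- by rewrite (unsplitK (inr _)) enum_rankK.
Qed.

Lemma sejoin_index_ll i :
  sejoin_index (lshift _ (lshift _ i)) = inl (inl (enum_val i)).
Proof. by rewrite /sejoin_index (unsplitK (inl _)) (unsplitK (inl _)). Qed.

Lemma sejoin_index_lr i :
  sejoin_index (lshift _ (rshift _ i)) = inl (inr (enum_val i)).
Proof. by rewrite /sejoin_index (unsplitK (inl _)) (unsplitK (inr _)). Qed.

Lemma sejoin_index_r i : sejoin_index (rshift _ i) = inr (enum_val i).
Proof. by rewrite /sejoin_index (unsplitK (inr _)). Qed.

End SejoinIndex.

Section Sejoin.
Variables G1 G2 : sgraph.

Lemma degree_sejoin_ll (v : G1) :
  degree (inl (inl v) : sejoin G1 G2) = degree v.
Proof.
rewrite degreeE big_sumType /= big_sumType /= !inE big1 // add0n.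
rewrite [X in (_ + X)%N]big1 // addn0.
exact: sum_edges_at.
Qed.

Lemma degree_sejoin_lr (e : edge G1) :
  degree (inl (inr e) : sejoin G1 G2) = (2 + #|G2|)%N.
Proof.
rewrite degreeE big_sumType /= big_sumType /= inE sum1_card.
rewrite [X in (_ + X + _)%N]big1 // addn0; congr (_ + _)%N.
rewrite -(card_edge (valP e)) -sum1_card [RHS]big_mkcond.
by apply: eq_bigr => v _; case: ifP.
Qed.

Lemma degree_sejoin_r (w : G2) :
  degree (inr w : sejoin G1 G2) = (#|edges G1| + degree w)%N.
Proof.
rewrite degreeE big_sumType /= big_sumType /= -degreeE; congr (_ + _)%N.
rewrite big1 => [|v _]; last by rewrite inE.
rewrite (eq_bigr (fun=> 1%N)) => [|e _]; last by rewrite inE.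
by rewrite sum1_card card_sig.
Qed.

Lemma det_shift_sejoin (R : rcfType) (K : comNzRingType) (f : {rmorphism R -> K})
    (z : K) (r : nat) : regular r G1 ->
  \det (z%:M - map_mx f (laplacian R (sejoin G1 G2))) =
  \det (block_mx
    (block_mx (z - r%:R)%:M (incidence_mx G1 K)
              (incidence_mx G1 K)^T (z - 2 - #|G2|%:R)%:M)
    (col_mx 0 (const_mx 1)) (row_mx 0 (const_mx 1))
    ((z - #|edges G1|%:R)%:M - map_mx f (laplacian R G2))).
Proof.
move=> reg.
(* The entries of z I - L as a function of two vertices, independent of any numbering. *)
pose F (x y : sejoin G1 G2) : K := (z - (degree x)%:R) *+ (x == y) + (adj x y)%:R.
have -> : z%:M - map_mx f (laplacian R (sejoin G1 G2)) =
    \matrix_(i, j) F (enum_val i) (enum_val j).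
  apply/matrixP => i j; rewrite !mxE rmorphB rmorphMn !rmorph_nat /F.
  by rewrite (inj_eq enum_val_inj) opprB addrA mulrnBl addrAC.
rewrite (det_reindex F (sejoin_index_bij G1 G2)); congr (\det _).
have eq_ll (u v : G1) : (inl (inl u) == inl (inl v) :> sejoin G1 G2) = (u == v) by [].
have eq_lr (d e : edge G1) : (inl (inr d) == inl (inr e) :> sejoin G1 G2) = (d == e) by [].
have eq_r (u v : G2) : (inr u == inr v :> sejoin G1 G2) = (u == v) by [].
apply/matrixP => i j; rewrite mxE /F.
case: (split_ordP i) => i' ->; case: (split_ordP j) => j' ->.
- rewrite block_mxEul.
  case: (split_ordP i') => i1 ->; case: (split_ordP j') => j1 ->.
  + rewrite block_mxEul !sejoin_index_ll degree_sejoin_ll reg mxE addr0.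
    by rewrite eq_ll (inj_eq enum_val_inj).
  + by rewrite block_mxEur sejoin_index_ll sejoin_index_lr mxE mulr0n add0r.
  + by rewrite block_mxEdl sejoin_index_ll sejoin_index_lr !mxE mulr0n add0r.
  + rewrite block_mxEdr !sejoin_index_lr degree_sejoin_lr mxE addr0.
    by rewrite eq_lr (inj_eq enum_val_inj) natrD opprD addrA.
- rewrite block_mxEur sejoin_index_r.
  case: (split_ordP i') => i1 ->.
  + by rewrite sejoin_index_ll col_mxEu mxE mulr0n add0r /= inE.
  + by rewrite sejoin_index_lr col_mxEd mxE mulr0n add0r /= inE.
- rewrite block_mxEdl sejoin_index_r.
  case: (split_ordP j') => j1 ->.
  + by rewrite sejoin_index_ll row_mxEl mxE mulr0n add0r /= inE.
  + by rewrite sejoin_index_lr row_mxEr mxE mulr0n add0r /= inE.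
- rewrite block_mxEdr !sejoin_index_r degree_sejoin_r !mxE.
  rewrite rmorphB rmorphMn !rmorph_nat eq_r (inj_eq enum_val_inj).
  by rewrite opprB addrA addrAC -mulrnBl natrD opprD addrA addrAC.
Qed.

End Sejoin.

(** * Assembly over a field containing the polynomials *)

Lemma quadratic_neq0 (R : idomainType) (u v w : R) :
  ('X - u%:P) * ('X - v%:P) - w%:P != 0.
Proof.
apply: contraTneq isT => /(congr1 (fun p : {poly R} => p`_2)) /eqP.
by rewrite mulrBl coefB coefB coefXM coefCM !coefB !coefX !coefC /= !subr0 mulr0
  subr0 oner_eq0.
Qed.

(** [U] and [V] stand for a^m and a^-n. By [n * r = 2 * m], the scalar factors other than [U], [V],
    [P1], [P2] multiply to (t (a y - p m) - 2 r m p) / a = (x - r)(a y - p m) - 2 r y, which is [x]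
    times the quadratic. *)
Lemma sejoin_det_formula (K : fieldType) (x n m r p U V P1 P2 : K)
    (a := x - 2 - p) (y := x - m) (t := a * (x - r) - 2 * r)
    (c := p / y) (d := c * r / (a - c * m)) :
  a != 0 -> y != 0 -> a * y - p * m != 0 -> t != 0 -> n * r = 2 * m ->
  V * (1 - d * r * n / t) * (t * P1) * (U * (1 - c * m / a)) * (y * P2) =
  x * (U * V) * (x ^+ 2 - (2 + r + m + p) * x + (r * p + r * m + 2 * m)) * P2 * P1.
Proof.
move=> a0 y0 ay0 t0 nr.
have -> : d * r * n = c * r * (2 * m) / (a - c * m).
  by rewrite -nr /d; ring.
rewrite /c /t /y /a in a0 y0 ay0 t0 *.
by field; rewrite a0 y0 ay0 t0.
Qed.

(* The field of fractions enters only as an abstract field K: conversion checks in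
   the concrete {fraction {poly R}} do not terminate in reasonable time. *)
Lemma char_poly_sejoin (R : rcfType) (K : fieldType) (phi : {rmorphism {poly R} -> K})
    (G1 G2 : sgraph) (r1 : nat) (n1 := #|G1|) (m1 := #|edges G1|) (n2 := #|G2|) :
  injective phi -> (0 < n1)%N -> (0 < n2)%N -> regular r1 G1 ->
  phi (char_poly (laplacian R (sejoin G1 G2))) =
  phi 'X
  * phi ('X - 2%:R - n2%:R) ^ (m1%:Z - n1%:Z)
  * phi ('X^2 - (2 + r1 + m1 + n2)%:R * 'X + (r1 * n2 + r1 * m1 + 2 * m1)%:R)
  * phi (\prod_(2 <= i < n2.+1) ('X - m1%:R - (mu R G2 i)%:P))
  * phi (\prod_(2 <= i < n1.+1)
       ('X^2 - (2 + r1 + n2)%:R * 'X + (r1 * n2)%:R + (mu R G1 i)%:P)).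
Proof.
move=> phi_inj n1_gt0 n2_gt0 hr1.
pose x := phi 'X.
have quadE (b c : nat) :
    phi ('X^2 - b%:R * 'X + c%:R) = x ^+ 2 - b%:R * x + c%:R.
  by rewrite rmorphD rmorphB rmorphXn rmorphM !rmorph_nat.
rewrite !rmorph_prod !rmorphB !rmorph_nat quadE -/x.
under eq_bigr do rewrite !rmorphB rmorph_nat -/x.
under [in X in _ * X]eq_bigr do rewrite rmorphD quadE.
pose f := (phi \o @polyC R) : {rmorphism R -> K}.
have detE : phi (char_poly (laplacian R (sejoin G1 G2))) =
    \det (x%:M - map_mx f (laplacian R (sejoin G1 G2))).
  rewrite /char_poly -det_map_mx; congr (\det _).
  by apply/matrixP => i j; rewrite !mxE /= rmorphB rmorphMn.
have natE k : k%:R = phi (k%:R%:P) by rewrite polyC_natr rmorph_nat.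
pose a := x - 2 - n2%:R; pose y := x - m1%:R; pose t := a * (x - r1%:R) - 2 * r1%:R.
have aE : a = x - (2 + n2)%:R by rewrite natrD opprD addrA.
(* Every denominator is the image of a monic polynomial of degree 1 or 2 in ['X], hence nonzero by
   injectivity of [phi]. *)
have phi_neq0 p : p != 0 -> phi p != 0.
  by apply: contra => /eqP p0; apply/eqP/phi_inj; rewrite p0 rmorph0.
have lin_neq0 k : x - k%:R != 0 by rewrite natE -rmorphB phi_neq0 ?polyXsubC_eq0.
have quad_neq0 j k l : (x - j%:R) * (x - k%:R) - l%:R != 0.
  by rewrite !natE -!rmorphB -rmorphM -rmorphB phi_neq0 ?quadratic_neq0.
have a0 : a != 0 by rewrite aE lin_neq0.
have ay0 : a * y - n2%:R * m1%:R != 0 by rewrite aE -natrM quad_neq0.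
have t0 : t != 0 by rewrite /t aE -(natrM _ 2) quad_neq0.
(* Handshake lemma for a regular graph. *)
have nr : n1%:R * r1%:R = 2 * m1%:R :> K.
  rewrite -!natrM -sum_degree (eq_bigr (fun=> r1)) => [|v _]; last exact: hr1.
  by rewrite sum_nat_const.
have acm0 : a - n2%:R / y * m1%:R != 0.
  have -> : a - n2%:R / y * m1%:R = (a * y - n2%:R * m1%:R) / y.
    by field; exact: lin_neq0.
  by rewrite mulf_neq0 ?invr_eq0 ?lin_neq0.
rewrite detE (det_shift_sejoin G2 f x hr1).
have mE : #|edge G1| = m1 by rewrite card_sig.
have BE : incidence_mx G1 K = map_mx f (incidence_mx G1 R).
  by apply/matrixP => i j; rewrite !mxE rmorph_nat.
have L_ones (G : sgraph) q : map_mx f (laplacian R G) *m const_mx 1 = 0 :> 'M_(#|G|, q).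
  by rewrite -(rmorph1 f) -map_const_mx -map_mxM laplacian_ones map_mx0.
rewrite (@det_sejoin_block _ _ _ _ a _ y t r1%:R _ (map_mx f (laplacian R G1)))
  ?mE ?lin_neq0 //; first last.
- by move=> q; rewrite (incidence_mul_ones _ _ hr1);
  apply/matrixP => i j; rewrite !mxE mulr1.
- by rewrite BE map_trmx -map_mxM (incidence_mul_tr R hr1) map_mxB
  map_scalar_mx rmorph_nat natrM.
rewrite det_add_laplacian // det_shift_laplacian //.
have -> : (x - 2 - n2%:R) ^ (m1%:Z - n1%:Z) = a ^+ m1 * a ^- n1.
  by rewrite expfzDr // exprnN.
(* Expanding [t] gives x^2 - (2 + r1 + n2) x + r1 n2, so each quadratic factor is [t] shifted by an
   eigenvalue of G1. *)
rewrite [X in _ = _ * X](eq_bigr (fun i => t + phi (mu R G1 i)%:P)) => [|i _]; last first.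
  by rewrite /t /a; ring.
have -> : (2 + r1 + m1 + n2)%:R = 2 + r1%:R + m1%:R + n2%:R :> K by rewrite !natrD.
have -> : (r1 * n2 + r1 * m1 + 2 * m1)%:R =
    r1%:R * n2%:R + r1%:R * m1%:R + 2 * m1%:R :> K by rewrite -!natrM -!natrD.
exact: sejoin_det_formula.
Qed.

Theorem theorem3p5 (R : rcfType) (G1 G2 : sgraph) (n1 m1 r1 n2 : nat)
  (hn1 : #|G1| = n1) (hm1 : #|edges G1| = m1) (hn2 : #|G2| = n2)
  (n1_gt0 : (0 < n1)%N) (n2_gt0 : (0 < n2)%N)
  (hr1 : regular r1 G1) :
  (char_poly (laplacian R (sejoin G1 G2)))%:F =
  'X%:F
  * ('X - 2%:R - n2%:R)%:F ^ (m1%:Z - n1%:Z)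
  * ('X^2 - (2 + r1 + m1 + n2)%:R * 'X
       + (r1 * n2 + r1 * m1 + 2 * m1)%:R)%:F
  * (\prod_(2 <= i < n2.+1) ('X - m1%:R - (mu R G2 i)%:P))%:F
  * (\prod_(2 <= i < n1.+1)
       ('X^2 - (2 + r1 + n2)%:R * 'X + (r1 * n2)%:R + (mu R G1 i)%:P))%:F
  :> {fraction {poly R}}.
Proof.
by subst; apply: char_poly_sejoin => // p q /eqP; rewrite tofrac_eq => /eqP.
Qed.
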